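(* Let $\bar{\mathbb{Q}}$ denote the set of real algebraic numbers. The set $$A := \{x \in \mathbb{R} : e^{\alpha x} \text{ is not normal for all } \alpha \in \bar{\mathbb{Q}}\setminus\{0\}\}$$ is a dense subset of $\mathbb{R}$. Moreover, there exists a non-normal number $x$ such that $e^{\alpha x}$ is non-normal for every $\alpha \in \bar{\mathbb{Q}}\setminus\{0\}$.
   Context: For an integer base $b\ge2$, a real number $x$ is $b$-normal if every finite word $w$ over $\{0,\dots,b-1\}$ appears with asymptotic frequency $b^{-|w|}$ in the fractional part of the $b$-ary expansion of $x$, where $|w|$ is the length of $w$ (the expansion is made unique by using a finite expansion whenever possible; for negative $x$ use $|x|$). A real number is normal if it is $b$-normal for every integer $b \ge 2$, and non-normal otherwise. *)

(* Defs.v *)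
From mathcomp Require Import all_boot all_order all_algebra.
From mathcomp Require Import all_classical all_reals all_analysis.
Set Implicit Arguments.
Unset Strict Implicit.
Unset Printing Implicit Defensive.
Import Order.TTheory GRing.Theory Num.Theory.
Import numFieldNormedType.Exports.
Local Open Scope classical_set_scope.
Local Open Scope ring_scope.

(* The k-th digit (from k = 0) of the fractional part of |x| in base b. The
   floor selects the finite expansion whenever |x| has one. *)
Definition frac_digit (R : realType) (b : nat) (x : R) (k : nat) : nat :=
  (Num.truncn (`|x| * b%:R ^+ k.+1)%R %% b)%N.

Definition occurs_at (R : realType) (b : nat) (x : R) (w : seq 'I_b)
    (i : nat) : bool :=
  [seq frac_digit b x k | k <- iota i (size w)] == [seq val d | d <- w].

Definition base_normal (R : realType) (b : nat) (x : R) : Prop :=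
  forall w : seq 'I_b,
    (count (occurs_at x w) (iota 0 N))%:R / N%:R @[N --> \oo]
      --> (b%:R ^- size w : R).

Definition normal_number (R : realType) (x : R) : Prop :=
  forall b : nat, (2 <= b)%N -> base_normal b x.

Definition real_algebraic (R : realType) (alpha : R) : Prop :=
  algebraicOver (ratr : rat -> R) alpha.

(* Main.v *)
Require Import Defs.
From mathcomp Require Import all_boot all_order all_algebra.
From mathcomp Require Import all_classical all_reals all_analysis.
From mathcomp Require Import zify lra.
Import Order.TTheory GRing.Theory Num.Theory.
Import numFieldNormedType.Exports.
Local Open Scope classical_set_scope.
Local Open Scope ring_scope.

(** The proof is by Baire category. If [y >= 0] lies extremely close above
    dyadic numbers [m / 2 ^ j] with [j] arbitrarily large, namely within
    [2 ^ - 4j], then the binary digits of [y] at the positions [j], ...,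
    [4j - 1] are all [0]. So infinitely often at least three quarters of the
    first [4j] digits are [0], and the frequency of [0] cannot tend to [1/2]:
    [y] is not normal ([nonnormal_of_above_dyadic]). Such [y] form a countable
    intersection of open sets [above_dyadic R n], each of which meets every
    interval ([above_dyadic_between]).

    The preimage of a dense open subset of the line under a continuous
    injective [g] is again dense and open, because [g] maps every interval onto
    an interval that is not a single point. By Baire's theorem, for countably
    many such [g] a dense set of [x] makes every nonnegative [g x] non-normal
    ([dense_nonnormal_values]). There are countably many real algebraic numbers
    ([countable_real_algebraic]), so this applies to all [x |-> exp (a x)] with
    [a] algebraic and nonzero, together with the identity; adding the identity
    makes [x] itself non-normal at any positive point of the dense set. *)

(** The index [n] bounds from below the exponent of the dyadic denominator, so
    a point of all these sets has such approximations with [j] unbounded. *)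
Definition above_dyadic (R : realType) (n : nat) : set R :=
  \bigcup_(j in [set j | (n < j)%N]) \bigcup_(m : int)
    [set` `]m%:~R / 2 ^+ j, m%:~R / 2 ^+ j + 2 ^- (4 * j)[].

Lemma open_above_dyadic (R : realType) n : open (above_dyadic R n).
Proof.
by apply: bigcup_open => j _; apply: bigcup_open => m _; exact: interval_open.
Qed.

(** The dyadic numbers with denominator [2 ^ j] have mesh [2 ^ - j], which is
    less than [b - a] for large [j]; points just above one of them inside
    [(a, b)] are still below [b]. *)
Lemma above_dyadic_between (R : realType) n (a b : R) : a < b ->
  exists2 y, above_dyadic R n y & a < y < b.
Proof.
move=> ab.
have [k kP] : exists k : nat, (b - a)^-1 < k%:R.
  by exists (Num.truncn (b - a)^-1).+1; exact: truncnS_gt.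
pose j := (n + k).+1.
have j2 : 0 < 2 ^+ j :> R by exact: exprn_gt0.
have mesh : 1 < (b - a) * 2 ^+ j.
  rewrite -ltr_pdivrMl ?subr_gt0// mulr1 (lt_trans kP)//.
  rewrite -natrX ltr_nat (leq_ltn_trans _ (ltn_expl j _))// /j; lia.
pose m := Num.floor (a * 2 ^+ j) + 1.
have am : a < m%:~R / 2 ^+ j by rewrite ltr_pdivlMr// floorD1_gt.
have mb : m%:~R / 2 ^+ j < b.
  rewrite ltr_pdivrMr//.
  have := floor_le (a * 2 ^+ j).
  rewrite /m intrD; lra.
have [y /andP[my yb]] : exists y, m%:~R / 2 ^+ j < y <
    Num.min b (m%:~R / 2 ^+ j + 2 ^- (4 * j)).
  set c := Num.min _ _; exists ((m%:~R / 2 ^+ j + c) / 2).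
  by rewrite !midf_lt// lt_min mb ltrDl invr_gt0 exprn_gt0.
move: yb; rewrite lt_min => /andP[yb ye].
exists y; last by rewrite (lt_trans am my).
exists j; first by rewrite /= /j; lia.
by exists m => //=; rewrite in_itv/= my.
Qed.

(** Multiplying [y] by [2 ^ k.+1] turns [m / 2 ^ j] into the even integer
    [m * 2 ^ (k.+1 - j)] and keeps the excess below [1], so the truncation is
    this even integer. *)
Lemma above_dyadic_digit (R : realType) (j : nat) (m : int) (y : R) (k : nat) :
  0 <= y -> y \in `]m%:~R / 2 ^+ j, m%:~R / 2 ^+ j + 2 ^- (4 * j)[ ->
  (j <= k < 4 * j)%N -> frac_digit 2 y k = 0%N.
Proof.
move=> y0; rewrite in_itv/= => /andP[my ym] /andP[jk kj].
have j2 : 0 < 2 ^+ j :> R by exact: exprn_gt0.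
have jle : (j <= 4 * j)%N by lia.
(* The excess is below 2 ^ - j, so y >= 0 forces m > -1. *)
have m0 : 0 <= m.
  suff : -1 < m by lia.
  rewrite -(ltr_int R) mulrN1z.
  have : 2 ^- (4 * j) <= 2 ^- j :> R.
    by rewrite lef_pV2 ?posrE ?exprn_gt0// ler_weXn2l// ler1n.
  rewrite -ltrBlDr in ym => h.
  have : - 2 ^- j < m%:~R / 2 ^+ j :> R by lra.
  by rewrite ltr_pdivlMr// mulNr mulVf// gt_eqF.
case: m m0 my ym => // m _; rewrite -pmulrn => my ym.
have kE : (k.+1 = j + (k - j).+1)%N by lia.
rewrite /frac_digit ger0_norm//.
suff -> : Num.truncn (y * 2 ^+ k.+1) = (m * 2 ^ (k - j).+1)%N.
  by rewrite expnS mulnCA modnMr.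
apply: truncn_def; set i := (k - j).+1.
have E : (m * 2 ^ i)%:R = m%:R / 2 ^+ j * 2 ^+ k.+1 :> R.
  by rewrite natrM natrX kE exprD mulrA divfK// gt_eqF.
rewrite E ler_pM2r ?exprn_gt0// (ltW my)/=.
apply: (@lt_le_trans _ _ ((m%:R / 2 ^+ j + 2 ^- (4 * j)) * 2 ^+ k.+1)).
  by rewrite ltr_pM2r ?exprn_gt0.
rewrite mulrDl -[leRHS]natr1 E lerD2l mulrC ler_pdivrMr ?exprn_gt0// mul1r.
by rewrite ler_weXn2l// ler1n.
Qed.

(** Normality in base [2] would make the frequency of the digit [0] eventually
    less than [3/4], while it is at least [3j / 4j] at the lengths [4j] given
    by the hypothesis. *)
Lemma nonnormal_of_above_dyadic (R : realType) (y : R) :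
  0 <= y -> (forall n, above_dyadic R n y) -> ~ normal_number y.
Proof.
move=> y0 yD /(_ 2%N isT [:: ord0]) /=.
rewrite expr1 => lim.
have half : 2^-1 < 3 / 4 :> R by lra.
have [n _ nP] := cvgr_lt _ lim _ half.
have [j /= nj [m _ ym]] := yD n.
have j0 : (0 < j)%N by lia.
have /nP /= : (n <= 4 * j)%N by lia.
apply/negP; rewrite -leNgt ler_pdivlMr ?ltr0n; last by lia.
rewrite natrM mulrA divfK; last by rewrite pnatr_eq0.
rewrite -natrM ler_nat.
have -> : (4 * j = j + 3 * j)%N by lia.
rewrite iotaD count_cat add0n.
suff -> : count (occurs_at y [:: ord0 : 'I_2]) (iota j (3 * j)) = (3 * j)%N.
  by rewrite leq_addl.
apply/eqP; rewrite -[X in _ == X](size_iota j) -all_count.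
apply/allP => k; rewrite mem_iota => jk.
by rewrite /occurs_at/= (@above_dyadic_digit _ j m)//; lia.
Qed.

(** On any interval [p, q] the values [g p] and [g q] differ, so some point of
    [above_dyadic R n] lies strictly between them; by the intermediate value
    theorem it is a value of [g] on [p, q]. *)
Lemma dense_preimage_above_dyadic (R : realType) n (g : R -> R) :
  continuous g -> injective g -> dense (g @^-1` above_dyadic R n).
Proof.
move=> cg ig U [p Up] oU.
have /nbhs_ballP[e /= e0 eU] : nbhs p U by exact: open_nbhs_nbhs.
pose q := p + e / 2.
have pq : p < q by rewrite ltrDl divr_gt0.
have gpq : Num.min (g p) (g q) < Num.max (g p) (g q).
  have : g p != g q by rewrite (inj_eq ig) lt_eqF.
  rewrite gt_min !lt_max !ltxx /= orbF; by case: ltgtP.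
have [y yD /andP[ay yb]] := @above_dyadic_between R n _ _ gpq.
have [|x xpq gx] := @IVT _ g p q y (ltW pq) (continuous_subspaceT cg).
  by rewrite !ltW.
exists x; split; last by rewrite /preimage/= gx.
apply: eU; move: xpq; rewrite in_itv/= => /andP[px xq].
rewrite /ball/= distrC ger0_norm ?subr_ge0//.
move: xq; rewrite /q; lra.
Qed.

(** Baire's theorem for sequences, transported along an injection of the index
    set into [nat]; the numbers outside its image get the whole space. *)
Lemma Baire_countable (K : realType) (U : completeNormedModType K)
    (I : Type) (D : set I) (F : I -> set U) :
  countable D -> (forall i, D i -> open (F i) /\ dense (F i)) ->
  dense (\bigcap_(i in D) F i).
Proof.
move=> /countable_injP[f finj] FD.
pose G k := \bigcap_(i in D `&` [set i | f i = k]) F i.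
have GE i : D i -> G (f i) = F i.
  move=> Di; apply/seteqP; split=> x; first by apply.
  by move=> Fx i' [Di' /finj ->] //; rewrite inE.
have : dense (\bigcap_k G k).
  apply: Baire => k.
  have [[i [Di <-]]|nk] := pselect (exists i, D i /\ f i = k).
    by rewrite GE//; exact: FD.
  have -> : G k = setT.
    by rewrite -subTset => x _ i [Di fik]; exfalso; apply: nk; exists i.
  split; first exact: openT.
  by move=> O [x Ox] _; exists x.
move=> dG O O0 oO; have [x [Ox Gx]] := dG O O0 oO.
by exists x; split=> // i Di; rewrite -GE//; exact: Gx.
Qed.

(** The condition [0 <= g x] comes from the digits being those of the absolute
    value: a negative number just above a dyadic one has its absolute value
    just below a dyadic one, hence long runs of the digit [1] instead of [0]. *)
Lemma dense_nonnormal_values (R : realType) (C : set (R -> R)) :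
  countable C -> (forall g, C g -> continuous g /\ injective g) ->
  dense [set x | forall g, C g -> 0 <= g x -> ~ normal_number (g x)].
Proof.
move=> cC CP.
pose F (gn : (R -> R) * nat) : set R := gn.1 @^-1` above_dyadic R gn.2.
have : dense (\bigcap_(gn in C `*` [set: nat]) F gn).
  apply: (@Baire_countable R); first exact: countableX.
  move=> [g n] [/= /CP[cg ig] _]; split; last exact: dense_preimage_above_dyadic.
  by apply: open_comp => [x _|]; [exact: cg | exact: open_above_dyadic].
move=> dF O O0 oO; have [x [Ox Fx]] := dF O O0 oO.
exists x; split=> // g Cg gx0.
by apply: nonnormal_of_above_dyadic => // n; exact: (Fx (g, n)).
Qed.

(** There are countably many rational polynomials, and a nonzero one has fewer
    roots than its size. *)
Lemma countable_real_algebraic (R : realType) :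
  countable [set a : R | real_algebraic a].
Proof.
pose Z (p : {poly rat}) := [set a : R | root (map_poly ratr p) a].
have finZ p : p != 0 -> finite_set (Z p).
  move=> p0; apply: contrapT => /(@infinite_set_fset _ _ (size p))[rs rsZ].
  apply/negP; rewrite -ltnNge -(size_map_poly (ratr : {rmorphism rat -> R})).
  apply: max_poly_roots; rewrite ?map_poly_eq0//.
    by apply/allP => a /rsZ.
  exact: finmap.fset_uniq.
apply: (@sub_countable _ _ _ (\bigcup_(p in [set p : {poly rat} | p != 0]) Z p)).
  by apply: subset_card_le => a [p p0 pa]; exists p.
apply: bigcup_countable; first exact: countableP.
by move=> p p0; exact/finite_set_countable/finZ.
Qed.

Theorem mainTheorem5 (R : realType) :
  dense [set x : R | forall alpha : R, real_algebraic alpha -> alpha != 0 ->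
                       ~ normal_number (expR (alpha * x))] /\
  exists x : R, ~ normal_number x /\
    forall alpha : R, real_algebraic alpha -> alpha != 0 ->
      ~ normal_number (expR (alpha * x)).
Proof.
pose A := [set a : R | real_algebraic a /\ a != 0].
pose C := id |` [set (fun x => expR (a * x)) | a in A].
have CP g : C g -> continuous g /\ injective g.
  move=> [->|[a [_ a0] <-]]; first by split=> // x; exact: cvg_id.
  split=> [x|x y /expR_inj/mulfI]; last exact.
  apply: (@continuous_comp _ _ _ (fun x => a * x) expR).
    exact: mulrl_continuous.
  exact: continuous_expR.
have cC : countable C.
  rewrite /C -bigcup2E; apply: bigcup_countable; first exact: countableP.
  move=> [_|[_|i _]] /=.
  - exact: countable1.
  - apply: (sub_countable (card_image_le _ _)).
    apply: (sub_countable _ (countable_real_algebraic R)).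
    by apply: subset_card_le => a [].
  - exact: countable0.
have nonnormal_exp x (a : R) : (forall g, C g -> 0 <= g x -> ~ normal_number (g x)) ->
    real_algebraic a -> a != 0 -> ~ normal_number (expR (a * x)).
  move=> Cx aalg a0; apply: (Cx (fun x => expR (a * x))); last exact: expR_ge0.
  by right; exists a.
have dC := @dense_nonnormal_values R C cC CP; split.
  move=> O O0 oO; have [x [Ox Cx]] := dC O O0 oO.
  by exists x; split=> // a; exact: nonnormal_exp.
have [|x [x0 Cx]] := dC [set y : R | y > 0] _ (@open_gt R 0).
  by exists 1 => /=.
exists x; split; last by move=> a; exact: nonnormal_exp.
apply: (Cx id); first by left.
exact: ltW x0.
Qed.
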